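(* Let $K$ and $L$ be compact convex subsets of $\mathbb{R}^n$, and let $1 \leq d \leq n$. The following are equivalent: (i) For every polytope $Q \subseteq K$ having at most $d+1$ vertices, there exists $v \in \mathbb{R}^n$ such that $Q + v \subseteq L$. (ii) For every $d$-dimensional linear subspace $\xi$ of $\mathbb{R}^n$, there exists $v \in \xi$ such that $K_\xi + v \subseteq L_\xi$.
   Context: For a set $S\subseteq\mathbb{R}^n$ and a linear subspace $\xi$, $S_\xi$ denotes the orthogonal projection of $S$ onto $\xi$. Named in the paper the ''Generalized Inscribed Polytope Containment Theorem''. *)

(* Defs.v *)
From HB Require Import structures.
From mathcomp Require Import all_boot all_order all_algebra.
From mathcomp Require Import all_classical all_reals all_analysis.
Set Implicit Arguments. Unset Strict Implicit. Unset Printing Implicit Defensive.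
Import Order.TTheory GRing.Theory Num.Theory.
Import numFieldNormedType.Exports.
Local Open Scope classical_set_scope.
Local Open Scope ring_scope.

Definition dotv (R : realType) (n : nat) (x y : 'rV[R]_n) : R :=
  (x *m y^T) 0 0.

Definition is_convex (R : realType) (n : nat) (A : set 'rV[R]_n) : Prop :=
  forall x y (t : R), A x -> A y -> 0 <= t -> t <= 1 ->
    A (t *: x + (1 - t) *: y).

Definition conv_hull (R : realType) (n : nat) (S : set 'rV[R]_n) : set 'rV[R]_n :=
  [set x | exists (m : nat) (w : 'I_m -> R) (p : 'I_m -> 'rV[R]_n),
     (forall i, 0 <= w i) /\ \sum_(i < m) w i = 1 /\
     (forall i, S (p i)) /\ x = \sum_(i < m) w i *: p i].

Definition is_polytope (R : realType) (n : nat) (Q : set 'rV[R]_n) : Prop :=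
  exists s : seq 'rV[R]_n, Q = conv_hull [set x | x \in s].

Definition is_vertex (R : realType) (n : nat) (Q : set 'rV[R]_n) (x : 'rV[R]_n) : Prop :=
  Q x /\ forall y z (t : R), Q y -> Q z -> 0 < t -> t < 1 ->
    x = t *: y + (1 - t) *: z -> y = x /\ z = x.

Definition at_most_vertices (R : realType) (n : nat) (Q : set 'rV[R]_n) (k : nat) : Prop :=
  exists f : 'I_k -> 'rV[R]_n, forall x, is_vertex Q x -> exists i, x = f i.

(* Linear subspaces of R^n are represented by square matrices A, the
   subspace being the row space of A, of dimension \rank A. *)
Definition in_subspace (R : realType) (n : nat) (A : 'M[R]_n) (x : 'rV[R]_n) : Prop :=
  (x <= A)%MS.

Definition is_orth_proj (R : realType) (n : nat) (A : 'M[R]_n) (x p : 'rV[R]_n) : Prop :=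
  in_subspace A p /\ forall u, in_subspace A u -> dotv (x - p) u = 0.

Definition proj_set (R : realType) (n : nat) (A : 'M[R]_n) (S : set 'rV[R]_n) : set 'rV[R]_n :=
  [set p | exists2 x, S x & is_orth_proj A x p].

Definition translate (R : realType) (n : nat) (Q : set 'rV[R]_n) (v : 'rV[R]_n) : set 'rV[R]_n :=
  [set y | exists2 q, Q q & y = q + v].

(* Main.v *)
(* (i) => (ii): in coordinates of the subspace, the projected containment asks for
   a common point of the compact convex sets L' - x' (x in K); any d+1 of them
   meet because the hull of the corresponding points of K translates into L, and
   Helly's theorem in dimension d concludes.

   (ii) => (i): a polytope with at most d+1 vertices is the hull of points
   q_0, ..., q_d.  Choose l_i in L such that the points w_i = l_i - q_i are as
   close to each other as possible.  The vectors u_i = \sum_j (w_i - w_j) sum to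
   zero, hence lie in a d-dimensional subspace.  Projecting onto that subspace
   gives competitors l'_i in L with <l'_i, u_i> = <q_i + v, u_i>, and the
   first-order condition at the minimum, tested against l'_i - l_i, forces all
   w_i to be equal, so that l_i = q_i + w_0. *)
Require Import Defs.
From HB Require Import structures.
From mathcomp Require Import all_boot all_order all_algebra.
From mathcomp Require Import all_classical all_reals all_analysis.
From mathcomp Require Import ring lra.
Set Implicit Arguments.
Unset Strict Implicit.
Unset Printing Implicit Defensive.
Import Order.TTheory GRing.Theory Num.Theory.
Import numFieldNormedType.Exports.
Local Open Scope classical_set_scope.
Local Open Scope ring_scope.

(** * Convex combinations and convex hulls *)

(* The weights are not normalised so that the induction over [r] goes through. *)
Lemma is_convex_barycenter (R : realType) (n : nat) (C : set 'rV[R]_n) (I : Type)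
    (r : seq I) (P : pred I) (w : I -> R) (p : I -> 'rV[R]_n) :
  is_convex C -> (forall i, P i -> 0 <= w i) ->
  (forall i, P i -> 0 < w i -> C (p i)) ->
  0 < \sum_(i <- r | P i) w i ->
  C ((\sum_(i <- r | P i) w i)^-1 *: \sum_(i <- r | P i) w i *: p i).
Proof.
move=> cC w0 Cp.
(* Nonnegative weights with sum zero all vanish, which covers the case where the tail of the list
   carries no weight. *)
have sum0 (s : seq I) : \sum_(i <- s | P i) w i = 0 -> \sum_(i <- s | P i) w i *: p i = 0.
  elim: s => [|i s IH]; rewrite ?big_nil// !big_cons; case: ifP => // Pi.
  move/eqP; rewrite paddr_eq0 ?w0 ?sumr_ge0// => /andP[/eqP-> /eqP/IH ->].
  by rewrite scale0r addr0.
elim: r => [|i r IH]; first by rewrite big_nil ltxx.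
rewrite !big_cons; case: ifP => // Pi.
have := sum0 r; set W := \sum_(j <- r | P j) w j in IH *.
set S := \sum_(j <- r | P j) _ in IH * => WS.
have W0 : 0 <= W by apply: sumr_ge0.
have [wi0|wi_neq0] := eqVneq (w i) 0; first by rewrite wi0 scale0r !add0r.
have wi : 0 < w i by rewrite lt_def wi_neq0 w0.
have [WE|W_neq0] := eqVneq W 0.
  by rewrite WE (WS WE) !addr0 scalerA mulVf// scale1r => _; exact: Cp.
have Wgt : 0 < W by rewrite lt_def W_neq0 W0.
move=> _; have := cC (p i) (W^-1 *: S) (w i / (w i + W)) (Cp _ Pi wi) (IH Wgt).
have sgt : 0 < w i + W by rewrite addr_gt0.
rewrite divr_ge0 ?(ltW wi) ?(ltW sgt)// ler_pdivrMr// mul1r lerDl W0 => /(_ isT isT).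
rewrite !scalerA (_ : (1 - _) / W = (w i + W)^-1); last first.
  by field; rewrite !gt_eqF.
by rewrite mulrC scalerDr scalerA.
Qed.

Lemma conv_hull_min (R : realType) (n : nat) (S C : set 'rV[R]_n) :
  is_convex C -> S `<=` C -> conv_hull S `<=` C.
Proof.
move=> cC SC x [m [w [p [w0 [w1 [Sp ->]]]]]].
have := @is_convex_barycenter R n C _ (index_enum (ordinal m)) xpredT w p cC.
rewrite w1 invr1 scale1r; apply=> // i _ _.
exact/SC/Sp.
Qed.

Lemma sub_conv_hull (R : realType) (n : nat) (S : set 'rV[R]_n) : S `<=` conv_hull S.
Proof.
move=> x Sx; exists 1, (fun=> 1), (fun=> x).
by rewrite !big_ord1 scale1r; do !split.
Qed.

(** Two combinations are concatenated, with weights scaled by [t] and [1 - t]. *)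
Lemma is_convex_conv_hull (R : realType) (n : nat) (S : set 'rV[R]_n) :
  is_convex (conv_hull S).
Proof.
move=> x y t [m1 [w1 [p1 [w10 [w11 [Sp1 ->]]]]]] [m2 [w2 [p2 [w20 [w21 [Sp2 ->]]]]]] t0 t1.
exists (m1 + m2)%N.
exists (fun k => match fintype.split k with inl i => t * w1 i | inr j => (1 - t) * w2 j end).
exists (fun k => match fintype.split k with inl i => p1 i | inr j => p2 j end).
have spl i : fintype.split (lshift m2 i : 'I_(m1 + m2)) = inl i := unsplitK (inl i).
have spr i : fintype.split (rshift m1 i : 'I_(m1 + m2)) = inr i := unsplitK (inr i).
split; first by move=> k; case: fintype.split => i; rewrite mulr_ge0// subr_ge0.
split.
  rewrite big_split_ord /=.
  under eq_bigr do rewrite spl.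
  under [X in _ + X]eq_bigr do rewrite spr.
  by rewrite -!mulr_sumr w11 w21; lra.
split; first by move=> k; case: fintype.split => i.
rewrite big_split_ord /= !scaler_sumr.
under [X in _ = X + _]eq_bigr do rewrite spl -scalerA.
by under [X in _ = _ + X]eq_bigr do rewrite spr -scalerA.
Qed.

Lemma conv_hull_mono (R : realType) (n : nat) (S T : set 'rV[R]_n) :
  S `<=` T -> conv_hull S `<=` conv_hull T.
Proof.
by move=> ST; apply: conv_hull_min; [exact: is_convex_conv_hull|move=> x /ST/sub_conv_hull].
Qed.

(** * Vertices of convex hulls and of polytopes *)

(** The terms of a combination are grouped by whether their point equals [x]. The remaining ones are
    renormalised to [z], unless their total weight is zero. *)
Lemma conv_hull_split (R : realType) (n : nat) (S : set 'rV[R]_n) (x y : 'rV[R]_n) :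
  conv_hull S y ->
  y = x \/ exists a z, [/\ 0 <= a, a < 1, conv_hull (S `\ x) z & y = a *: x + (1 - a) *: z].
Proof.
move=> [m [w [p [w0 [w1 [Sp ->]]]]]].
set a := \sum_(i < m | p i == x) w i; set b := \sum_(i < m | p i != x) w i.
have ab : a + b = 1 by rewrite -w1 (bigID (fun i => p i == x)).
have a0 : 0 <= a by apply: sumr_ge0.
have b0 : 0 <= b by apply: sumr_ge0.
have -> : \sum_i w i *: p i = a *: x + \sum_(i < m | p i != x) w i *: p i.
  rewrite (bigID (fun i => p i == x))/= scaler_suml; congr (_ + _).
  by apply: eq_bigr => i /eqP ->.
have [b_eq0|b_neq0] := eqVneq b 0.
  left; have -> : a = 1 by lra.
  rewrite scale1r big1 ?addr0// => i pix.
  by rewrite (psumr_eq0P _ b_eq0) ?scale0r.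
have bgt : 0 < b by rewrite lt_def b_neq0.
right; exists a, (b^-1 *: \sum_(i < m | p i != x) w i *: p i); split=> //.
- lra.
- apply: is_convex_barycenter => //; first exact: is_convex_conv_hull.
  by move=> i /eqP pix _; apply: sub_conv_hull; split.
- by rewrite (_ : 1 - a = b) ?scalerA ?divff ?scale1r//; lra.
Qed.

(* Removing an extreme point from a convex set leaves a convex set. *)
Lemma vertex_conv_hull (R : realType) (n : nat) (S : set 'rV[R]_n) (x : 'rV[R]_n) :
  is_vertex (conv_hull S) x -> S x.
Proof.
move=> [hx xext]; apply: contrapT => Sx.
have: is_convex (conv_hull S `\ x).
  move=> y z t [hy yx] [hz zx] t0 t1; split; first exact: is_convex_conv_hull.
  have [->|t_neq0] := eqVneq t 0; first by rewrite scale0r add0r subr0 scale1r.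
  have [->|t_neq1] := eqVneq t 1; first by rewrite subrr scale0r addr0 scale1r.
  move=> /esym/(xext _ _ _ hy hz); rewrite !lt_def t_neq0 t0 eq_sym t_neq1 t1.
  by move=> /(_ isT isT)[].
move=> /conv_hull_min hmin; have [|_] := hmin S _ x hx; last exact.
by move=> y Sy; split; [exact: sub_conv_hull|move=> yx; apply: Sx; rewrite -yx].
Qed.

(** If [x] lies strictly between [y] and [z], the share of [x] in each of them is split off. Solving
    the resulting equation for [x] places it in the hull of the other points, unless [y] and [z]
    both equal [x]. *)
Lemma is_vertex_irredundant (R : realType) (n : nat) (S : set 'rV[R]_n) (x : 'rV[R]_n) :
  S x -> ~ conv_hull (S `\ x) x -> is_vertex (conv_hull S) x.
Proof.
move=> Sx hx; split; first exact: sub_conv_hull.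
move=> y z t /(@conv_hull_split _ _ _ x _) hy /(@conv_hull_split _ _ _ x) hz t0 t1 xE.
have cancel_x (s : R) (v : 'rV[R]_n) : 0 < s -> x = (1 - s) *: x + s *: v -> v = x.
  move=> s0 /(congr1 (fun u => s^-1 *: (u - (1 - s) *: x))).
  rewrite addrAC subrr add0r scalerBl scale1r opprB addrC subrK !scalerA.
  by rewrite mulVf ?gt_eqF// !scale1r.
have s0 : 0 < 1 - t by lra.
have comb (s : R) (v : 'rV[R]_n) : 0 < s -> conv_hull (S `\ x) v ->
    x <> (1 - s) *: x + s *: v.
  by move=> s_gt0 hv /(cancel_x _ _ s_gt0) vx; rewrite vx in hv.
case: hy hz => [yx|[a [y' [a0 a1 hy' yE]]]] [zx|[b [z' [b0 b1 hz' zE]]]] //.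
- subst y; have /comb-/(_ _ hz')[] : 0 < (1 - t) * (1 - b) by rewrite mulr_gt0//; lra.
  rewrite [LHS]xE zE scalerDr !scalerA addrA -scalerDl; congr (_ *: _ + _); lra.
- subst z; have /comb-/(_ _ hy')[] : 0 < t * (1 - a) by rewrite mulr_gt0//; lra.
  rewrite [LHS]xE yE scalerDr !scalerA addrAC -scalerDl; congr (_ *: _ + _); lra.
(* The points other than [x] carry total weight [s]; dividing by [s] merges [y'] and [z'] into one
   point of the hull without [x]. *)
- have ta : 0 < t * (1 - a) by rewrite mulr_gt0//; lra.
  have tb : 0 < (1 - t) * (1 - b) by rewrite mulr_gt0//; lra.
  have s_gt0 := addr_gt0 ta tb; set s := _ + _ in s_gt0.
  have hv : conv_hull (S `\ x)
      ((t * (1 - a) / s) *: y' + (1 - t * (1 - a) / s) *: z').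
    apply: is_convex_conv_hull => //; first by rewrite divr_ge0 ?ltW.
    by rewrite ler_pdivrMr// mul1r lerDl ltW.
  case: (comb s _ s_gt0 hv).
  rewrite [LHS]xE yE zE !scalerDr !scalerA addrACA -scalerDl.
  congr (_ *: _ + (_ *: _ + _ *: _)); rewrite /s; first lra.
    by field; rewrite -/s gt_eqF.
  by field; rewrite -/s gt_eqF.
Qed.

(** Induction on the length of the generating list: a listed point that is not a vertex is
    redundant, so deleting it leaves the hull unchanged. *)
Lemma polytope_vertices (R : realType) (n : nat) (Q : set 'rV[R]_n) :
  is_polytope Q -> Q `<=` conv_hull (is_vertex Q).
Proof.
move=> [s ->]; have [k] := ubnP (size s); elim: k s => // k IH s sk.
set S := [set x | x \in s].
have [h|] := pselect (forall x, S x -> is_vertex (conv_hull S) x).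
  exact: conv_hull_mono.
move=> /existsNP[x /not_implyP[Sx xNv]].
have hx : conv_hull (S `\ x) x.
  by apply: contrapT => h; apply/xNv/is_vertex_irredundant.
pose s' := [seq y <- s | y != x].
have S's : S `\ x `<=` [set y | y \in s'].
  by move=> y [Sy /eqP yx]; rewrite /s' /= mem_filter yx.
have -> : conv_hull S = conv_hull [set y | y \in s'].
  apply/seteqP; split; last first.
    by apply: conv_hull_mono => y /=; rewrite mem_filter => /andP[].
  apply: conv_hull_min; first exact: is_convex_conv_hull.
  move=> y Sy; have [->|/eqP yx] := eqVneq y x; first exact: conv_hull_mono hx.
  exact/sub_conv_hull/S's.
apply: IH; rewrite size_filter.
rewrite ltnS in sk; apply: leq_trans sk.
rewrite -(count_predC (predC1 x) s) -addn1 leq_add2l -has_count.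
by apply/hasP; exists x => //=; rewrite negbK.
Qed.

(** * Radon's argument and Helly's theorem *)

(** Appending a coordinate 1 to each point turns affine dependence into linear dependence of [k]
    rows in dimension [d + 1]. *)
Lemma radon_dependency (R : realType) (d k : nat) (p : 'I_k -> 'rV[R]_d) :
  (d.+1 < k)%N ->
  exists a : 'I_k -> R,
    [/\ \sum_i a i = 0, \sum_i a i *: p i = 0 & exists i, 0 < a i].
Proof.
move=> dk; pose M : 'M[R]_(k, d + 1) := row_mx (\matrix_i p i) (const_mx 1).
have : kermx M != 0.
  rewrite kermx_eq0 /row_free ltn_eqF//; apply: leq_ltn_trans (rank_leq_col _) _.
  by rewrite addn1.
case/rowV0Pn => a0 /sub_kermxP aM a0_neq0.
have sum0 (a : 'rV[R]_k) : a *m M = 0 -> \sum_i a 0 i = 0 /\ \sum_i a 0 i *: p i = 0.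
  rewrite mul_mx_row -row_mx0 => /eq_row_mx[ap a1]; split.
    move/matrixP/(_ 0 0): a1; rewrite !mxE => s0; rewrite -[RHS]s0.
    by apply: eq_bigr => i _; rewrite mxE mulr1.
  move: ap; rewrite mulmx_sum_row => s0; rewrite -[RHS]s0.
  by apply: eq_bigr => i _; rewrite rowK.
have pos (a : 'rV[R]_k) i : a *m M = 0 -> 0 < a 0 i -> exists a : 'I_k -> R,
    [/\ \sum_i a i = 0, \sum_i a i *: p i = 0 & exists i, 0 < a i].
  by move=> /sum0[? ?] ai; exists (fun i => a 0 i); split=> //; exists i.
case/rV0Pn: a0_neq0 => i; rewrite neq_lt => /orP[ai|]; last exact: pos.
by apply: (pos (- a0) i); rewrite ?mulNmx ?aM ?oppr0// mxE oppr_gt0.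
Qed.

(** Induction on the number of sets. Points [p i] lying in all sets but the [i]-th are affinely
    dependent, and the Radon point common to the hulls of the two sign classes lies in every set. *)
Lemma helly_finite (R : realType) (d : nat) (T : Type) (C : T -> set 'rV[R]_d) :
  (forall t, is_convex (C t)) ->
  (forall f : 'I_d.+1 -> T, \bigcap_i C (f i) !=set0) ->
  forall k (f : 'I_k -> T), \bigcap_i C (f i) !=set0.
Proof.
move=> cC hC; elim=> [|k IH] f; first by exists 0 => -[].
have [kd|dk] := leqP k.+1 d.+1.
  (* Fewer than [d.+1] sets are padded by repetition: [inord] sends out-of-range indices to a
     default one. *)
  have [y hy] := hC (fun i => f (inord i)).
  exists y => i _; have := hy (widen_ord kd i) I.
  by rewrite /= inord_val.
have /choice[p hp] : forall i, exists p, forall j, j != i -> C (f j) p.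
  move=> i; have [p hp] := IH (fun j => f (lift i j)).
  exists p => j; rewrite eq_sym => /unlift_some[l -> _]; exact: hp.
have [a [a_sum ap_sum [i0 ai0]]] := radon_dependency p dk.
pose W := \sum_(i | 0 < a i) a i.
have W0 : 0 < W.
  by rewrite /W (bigD1 i0)//= ltr_pwDl// sumr_ge0// => i /andP[/ltW].
have WN : \sum_(i | ~~ (0 < a i)) - a i = W.
  rewrite sumrN; apply/eqP; rewrite eqr_oppLR -addr_eq0 addrC; apply/eqP.
  by rewrite -[RHS]a_sum [RHS](bigID (fun i => 0 < a i)).
have WNp : \sum_(i | ~~ (0 < a i)) - a i *: p i = \sum_(i | 0 < a i) a i *: p i.
  under eq_bigr do rewrite scaleNr.
  rewrite sumrN; apply/eqP; rewrite eqr_oppLR -addr_eq0 addrC; apply/eqP.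
  by rewrite -[RHS]ap_sum [RHS](bigID (fun i => 0 < a i)).
exists (W^-1 *: \sum_(i | 0 < a i) a i *: p i) => j _.
(* The set [C (f j)] contains every [p i] with [i] in the sign class opposite to that of [j], so the
   Radon point is written over that class. *)
have [aj|aj] := ltP 0 (a j); last first.
  apply: is_convex_barycenter => // [i /ltW//|i ai _].
  by apply: hp; apply: contraTneq ai => <-; rewrite -leNgt.
rewrite -WNp -WN; apply: is_convex_barycenter; rewrite ?WN//.
  by move=> i; rewrite -leNgt oppr_ge0.
by move=> i ai _; apply: hp; apply: contraNneq ai => <-.
Qed.

(** The finite case gives the finite intersection property, applied to the closed sets [C t] inside
    the compact set [C t0]. *)
Lemma helly_compact (R : realType) (d : nat) (T : choiceType) (C : T -> set 'rV[R]_d) :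
  (forall t, is_convex (C t)) -> (forall t, compact (C t)) ->
  (forall f : 'I_d.+1 -> T, \bigcap_i C (f i) !=set0) ->
  \bigcap_t C t !=set0.
Proof.
move=> cC kC hC.
have [[t0 _]|T0] := pselect (exists t : T, True); last first.
  by exists 0 => t; case: T0; exists t.
have := kC t0; rewrite compact_In0 => /(_ T setT (fun t => C t0 `&` C t)) [||y hy].
- exists C => // t _; apply: compact_closed => //; exact: norm_hausdorff.
(* Putting [t0] at the head of the list places the common point in [C t0] as well. *)
- move=> D _; pose s := t0 :: finmap.enum_fset D.
  have [y hy] := helly_finite cC hC (fun i : 'I_(size s) => nth t0 s i).
  have ys t : t \in s -> C t y.
    move=> ts; have ti : (index t s < size s)%N by rewrite index_mem.
    by have := hy (Ordinal ti) I; rewrite /= nth_index.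
  by exists y => t /= tD; split; apply: ys; rewrite inE ?eqxx// tD orbT.
- by exists y => t _; have [] := hy t I.
Qed.

(** * Continuity of maps into matrix spaces *)

Lemma continuous_mx (R : realType) (T : topologicalType) (m n : nat)
    (f : T -> 'M[R]_(m, n)) :
  (forall i j, continuous (fun x => f x i j)) -> continuous f.
Proof.
move=> fc x A [P Px PA].
have : \forall y \near x, forall i j, P i j (f y i j).
  by apply: filter_forall => i; apply: filter_forall => j; apply: fc; exact: Px.
by apply: filterS => y Py; apply: PA.
Qed.

Lemma continuous_affine_rV (R : realType) (n d : nat) (B : 'M[R]_(n, d)) (c : 'rV[R]_d) :
  continuous (fun x : 'rV[R]_n => x *m B + c).
Proof.
apply: continuous_mx => i j.
rewrite (_ : (fun x => _) =
  (fun x : 'rV[R]_n => \sum_k x i k * B k j + c i j)); last first.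
  by apply/funext => x; rewrite !mxE.
have cf : continuous (fun x : 'rV[R]_n => \sum_k x i k * B k j).
  apply: (@continuous_big _ _ +%R) => [|k _]; first exact: add_continuous.
  move=> x; apply: (@continuousM _ _ (fun x : 'rV[R]_n => x i k) (fun=> B k j)).
    exact: coord_continuous.
  exact: cst_continuous.
move=> x; apply: (@continuousD _ _ _ _ (fun=> c i j)); first exact: cf.
exact: cst_continuous.
Qed.

(** * The inner product *)

Lemma dotvE (R : realType) (n : nat) (x y : 'rV[R]_n) : dotv x y = \sum_k x 0 k * y 0 k.
Proof. by rewrite /dotv mxE; apply: eq_bigr => k _; rewrite mxE. Qed.

Lemma dotvC (R : realType) (n : nat) (x y : 'rV[R]_n) : dotv x y = dotv y x.
Proof. by rewrite !dotvE; apply: eq_bigr => k _; rewrite mulrC. Qed.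

Lemma dotvDl (R : realType) (n : nat) (x y z : 'rV[R]_n) :
  dotv (x + y) z = dotv x z + dotv y z.
Proof. by rewrite /dotv mulmxDl mxE. Qed.

Lemma dotvZl (R : realType) (n : nat) (a : R) (x y : 'rV[R]_n) :
  dotv (a *: x) y = a * dotv x y.
Proof. by rewrite /dotv -scalemxAl mxE. Qed.

Lemma dotvNl (R : realType) (n : nat) (x y : 'rV[R]_n) : dotv (- x) y = - dotv x y.
Proof. by rewrite -scaleN1r dotvZl mulN1r. Qed.

Lemma dotvDr (R : realType) (n : nat) (x y z : 'rV[R]_n) :
  dotv z (x + y) = dotv z x + dotv z y.
Proof. by rewrite !(dotvC z) dotvDl. Qed.

Lemma dotvNr (R : realType) (n : nat) (x y : 'rV[R]_n) : dotv y (- x) = - dotv y x.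
Proof. by rewrite !(dotvC y) dotvNl. Qed.

Lemma dotvZr (R : realType) (n : nat) (a : R) (x y : 'rV[R]_n) :
  dotv y (a *: x) = a * dotv y x.
Proof. by rewrite !(dotvC y) dotvZl. Qed.

Lemma dotv0r (R : realType) (n : nat) (x : 'rV[R]_n) : dotv x 0 = 0.
Proof. by rewrite -(scale0r 0) dotvZr mul0r. Qed.

Lemma dotv_suml (R : realType) (n : nat) (I : finType) (x : I -> 'rV[R]_n) (y : 'rV[R]_n) :
  dotv (\sum_i x i) y = \sum_i dotv (x i) y.
Proof. by rewrite /dotv mulmx_suml summxE. Qed.

Lemma dotv_sumr (R : realType) (n : nat) (I : finType) (x : I -> 'rV[R]_n) (y : 'rV[R]_n) :
  dotv y (\sum_i x i) = \sum_i dotv y (x i).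
Proof. by rewrite dotvC dotv_suml; apply: eq_bigr => i _; rewrite dotvC. Qed.

Lemma dotvv_ge0 (R : realType) (n : nat) (x : 'rV[R]_n) : 0 <= dotv x x.
Proof. by rewrite dotvE sumr_ge0// => k _; rewrite -expr2 sqr_ge0. Qed.

Lemma dotvv_eq0 (R : realType) (n : nat) (x : 'rV[R]_n) : dotv x x = 0 -> x = 0.
Proof.
rewrite dotvE => xx0; apply/rowP => k; rewrite mxE; apply/eqP.
rewrite -sqrf_eq0 expr2 (psumr_eq0P _ xx0)// => j _.
by rewrite -expr2 sqr_ge0.
Qed.

(** * Orthogonal projections and subspaces in coordinates *)

(** If [x] kills the Gram matrix, then [x *m B] has squared norm zero. *)
Lemma gram_unitmx (R : realType) (m n : nat) (B : 'M[R]_(m, n)) :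
  row_free B -> B *m B^T \in unitmx.
Proof.
move=> Bfree; rewrite -row_free_unit -kermx_eq0; apply/rowV0P => x /sub_kermxP.
rewrite mulmxA => xBB; apply/eqP; rewrite -(mulmx_free_eq0 _ Bfree); apply/eqP.
by apply: dotvv_eq0; rewrite /dotv trmx_mul mulmxA xBB mul0mx mxE.
Qed.

(** Orthogonality need only be tested on a basis of the subspace, so the projection is determined by
    the inner products with that basis. *)
Lemma is_orth_projP (R : realType) (n : nat) (A : 'M[R]_n) (x p : 'rV[R]_n) :
  is_orth_proj A x p <->
  (p <= A)%MS /\ p *m (row_base A)^T = x *m (row_base A)^T.
Proof.
set B := row_base A; split=> -[pA pE]; split=> //.
  apply/rowP => j; apply/eqP; rewrite eq_sym -subr_eq0; apply/eqP.
  have uA : in_subspace A (row j B).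
    by rewrite /in_subspace -(eq_row_base A) row_sub.
  by rewrite -[RHS](pE _ uA) /dotv tr_row colE mulmxA -colE mulmxBl !mxE.
move=> u; rewrite /in_subspace -(eq_row_base A) => /submxP[c ->].
by rewrite /dotv trmx_mul mulmxA mulmxBl pE subrr mul0mx mxE.
Qed.

Lemma orth_proj_exists (R : realType) (n : nat) (A : 'M[R]_n) (x : 'rV[R]_n) :
  exists p, is_orth_proj A x p.
Proof.
set B := row_base A; exists (x *m B^T *m invmx (B *m B^T) *m B); apply/is_orth_projP.
split; first by rewrite -(eq_row_base A) submxMl.
by rewrite -mulmxA mulmxKV// gram_unitmx// row_base_free.
Qed.

(** The first [\rank U] rows of the invertible matrix [row_ebase U] span [U]; its first [d] rows
    span the larger space. *)
Lemma extend_subspace (R : fieldType) (m n d : nat) (U : 'M[R]_(m, n)) :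
  (\rank U <= d)%N -> (d <= n)%N -> exists A : 'M[R]_n, \rank A = d /\ (U <= A)%MS.
Proof.
move=> Ud dn; exists (pid_mx d *m row_ebase U); split.
  by rewrite mxrankMfree ?rank_pid_mx// row_free_unit row_ebase_unit.
rewrite -[X in (X <= _)%MS](mulmx_ebase U).
have -> : (pid_mx (\rank U) : 'M[R]_(m, n)) = pid_mx (\rank U) *m (pid_mx d : 'M[R]_n).
  rewrite mul_pid_mx (minn_idPl Ud) (minn_idPr _)//; exact: leq_trans dn.
by rewrite mulmxA -[X in (X <= _)%MS]mulmxA submxMl.
Qed.

(** * From inscribed polytopes to projections *)

Lemma inscribed_polytopes_projections (R : realType) (n : nat)
    (K L : set 'rV[R]_n) (A : 'M[R]_n) :
  is_convex K -> compact L -> is_convex L ->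
  (forall Q : set 'rV[R]_n, is_polytope Q -> at_most_vertices Q (\rank A).+1 ->
     Q `<=` K -> exists v : 'rV[R]_n, translate Q v `<=` L) ->
  exists v : 'rV[R]_n, in_subspace A v /\ translate (proj_set A K) v `<=` proj_set A L.
Proof.
move=> cK kL cL QKL; set B := row_base A.
(* [C t] collects, in coordinates with respect to [B], the translations that carry the projection of
   [t] into that of [L]. *)
pose C (t : set_type K) := [set l *m B^T + - (val t *m B^T) | l in L].
have cC t : is_convex (C t).
  move=> _ _ s [l Ll <-] [l' Ll' <-] s0 s1.
  exists (s *: l + (1 - s) *: l'); first exact: cL.
  rewrite mulmxDl -!scalemxAl !scalerDr addrACA -scalerDl.
  by rewrite [s + _]addrC subrK scale1r.
have kC t : compact (C t).
  apply: continuous_compact => //; apply: continuous_subspaceT.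
  exact: continuous_affine_rV.
have hC (f : 'I_(\rank A).+1 -> set_type K) : \bigcap_i C (f i) !=set0.
  (* The vertices of this hull are among its [(\rank A).+1] generators, so the hypothesis translates
     it into [L]. *)
  pose s := [seq val (f i) | i <- enum 'I_(\rank A).+1].
  have [|||v hv] := QKL (conv_hull [set x | x \in s]).
  - by exists s.
  - exists (val \o f) => x /vertex_conv_hull /mapP[i _ ->]; by exists i.
  - apply: conv_hull_min => // x /mapP[i _ ->]; exact: set_valP.
  exists (v *m B^T) => i _; exists (val (f i) + v).
    apply: hv; exists (val (f i)) => //; apply: sub_conv_hull.
    by apply/mapP; exists i => //; rewrite mem_enum.
  by rewrite mulmxDl addrAC subrr add0r.
have [y hy] := helly_compact cC kC hC.
(* This is the vector of the subspace whose inner products with the basis [B] are the coordinates of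
   [y]. *)
exists (y *m invmx (B *m B^T) *m B); split.
  by rewrite /in_subspace -(eq_row_base A) submxMl.
move=> _ [p [x Kx /is_orth_projP[pA pE]] ->].
have [l Ll lE] := hy (SigSub (mem_set Kx)) I.
exists l => //; apply/is_orth_projP; split.
  by rewrite addmx_sub// -(eq_row_base A) submxMl.
rewrite mulmxDl pE -[X in _ + X]mulmxA mulmxKV ?gram_unitmx ?row_base_free//.
by rewrite -lE addrC subrK.
Qed.

(** * Spread of a configuration and its minimisation *)

(* Inner product of two configurations of points modulo simultaneous translation. *)
Definition spread (R : realType) (n k : nat) (x y : 'I_k -> 'rV[R]_n) : R :=
  \sum_i \sum_j dotv (x i - x j) (y i - y j).

(** Exchanging [i] and [j] in the half containing [y j] reproduces the half containing [y i], whence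
    the factor 2. *)
Lemma spreadE (R : realType) (n k : nat) (x y : 'I_k -> 'rV[R]_n) :
  spread x y = 2 * \sum_i dotv (\sum_j (x i - x j)) (y i).
Proof.
pose S := \sum_i \sum_j dotv (x i - x j) (y i).
have -> : spread x y = S - \sum_i \sum_j dotv (x i - x j) (y j).
  rewrite /S -sumrB; apply: eq_bigr => i _; rewrite -sumrB; apply: eq_bigr => j _.
  by rewrite dotvDr dotvNr.
rewrite [X in _ - X]exchange_big /= -sumrN.
rewrite [X in S + X](_ : _ = S).
  by rewrite mulrDl mul1r; congr (_ + _); apply: eq_bigr => i _; rewrite dotv_suml.
apply: eq_bigr => i _; rewrite -sumrN; apply: eq_bigr => j _.
by rewrite -dotvNl opprB.
Qed.

Lemma spread_line (R : realType) (n k : nat) (x y : 'I_k -> 'rV[R]_n) (t : R) :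
  spread (fun i => x i + t *: y i) (fun i => x i + t *: y i) =
  spread x x + t * (2 * spread x y + t * spread y y).
Proof.
have -> : spread x x + t * (2 * spread x y + t * spread y y) =
    spread x x + t * 2 * spread x y + t * t * spread y y by ring.
rewrite /spread !mulr_sumr -!big_split; apply: eq_bigr => i _ /=.
rewrite !mulr_sumr -!big_split; apply: eq_bigr => j _ /=.
rewrite opprD addrACA -scalerBr; move: (x i - x j) (y i - y j) => a b.
by rewrite !dotvDl !dotvDr !dotvZl !dotvZr (dotvC b a); ring.
Qed.

Lemma spread_ge0 (R : realType) (n k : nat) (x : 'I_k -> 'rV[R]_n) : 0 <= spread x x.
Proof. by apply: sumr_ge0 => i _; apply: sumr_ge0 => j _; exact: dotvv_ge0. Qed.

Lemma spread_eq0 (R : realType) (n k : nat) (x : 'I_k -> 'rV[R]_n) i j :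
  spread x x = 0 -> x i = x j.
Proof.
move=> x0; apply/eqP; rewrite -subr_eq0; apply/eqP/dotvv_eq0.
have x_ge0 l : 0 <= \sum_j dotv (x l - x j) (x l - x j).
  by apply: sumr_ge0 => m _; exact: dotvv_ge0.
have /(_ i isT) xi0 := psumr_eq0P (fun l _ => x_ge0 l) x0.
by have /(_ j isT) := psumr_eq0P (fun m _ => dotvv_ge0 (x i - x m)) xi0.
Qed.

(** A negative slope [b] would make the expression negative for small positive [t]. *)
Lemma quadratic_slope_ge0 (R : realFieldType) (b c : R) :
  (forall t, 0 <= t -> t <= 1 -> 0 <= t * (b + t * c)) -> 0 <= b.
Proof.
move=> h; rewrite leNgt; apply/negP => b0.
have c0 : 0 <= b + c by have := h 1 ler01 (lexx _); lra.
(* Since [b + c] is nonnegative and [b] negative, this lies in the unit interval, and [b + t * c]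
   becomes [b * (1 - b) / (1 + c - b)], which is negative. *)
pose t := - b / (1 + c - b).
have den : 0 < 1 + c - b by lra.
have t0 : 0 < t by rewrite divr_gt0//; lra.
have t1 : t <= 1 by rewrite ler_pdivrMr//; lra.
have := h t (ltW t0) t1; rewrite pmulr_rge0//.
have -> : b + t * c = b * (1 - b) / (1 + c - b) by rewrite /t; field; rewrite gt_eqF.
by rewrite pmulr_lge0 ?invr_gt0// nmulr_rge0//; lra.
Qed.

Lemma continuous_dotv (R : realType) (T : topologicalType) (n : nat) (f g : T -> 'rV[R]_n) :
  (forall l, continuous (fun x => f x 0 l)) -> (forall l, continuous (fun x => g x 0 l)) ->
  continuous (fun x => dotv (f x) (g x)).
Proof.
move=> cf cg; under eq_fun do rewrite dotvE.
apply: (@continuous_big _ _ +%R) => [|l _]; first exact: add_continuous.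
by move=> x; apply: continuousM; [exact: cf|exact: cg].
Qed.

Lemma continuous_spread (R : realType) (T : topologicalType) (n k : nat)
    (f : 'I_k -> T -> 'rV[R]_n) (q : 'I_k -> 'rV[R]_n) :
  (forall i l, continuous (fun x => f i x 0 l)) ->
  continuous (fun x => spread (fun i => f i x - q i) (fun i => f i x - q i)).
Proof.
move=> cf.
apply: (@continuous_big _ _ +%R) => [|i _]; first exact: add_continuous.
apply: (@continuous_big _ _ +%R) => [|j _]; first exact: add_continuous.
have cd l : continuous (fun x => (f i x - q i - (f j x - q j)) 0 l).
  rewrite (_ : (fun x => _) = (fun x => f i x 0 l - f j x 0 l + (q j 0 l - q i 0 l))).
    move=> x.
    apply: (@continuousD R R T (fun x => f i x 0 l - f j x 0 l)
                               (fun=> q j 0 l - q i 0 l)).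
      by apply: (@continuousB R R T (fun x => f i x 0 l) (fun x => f j x 0 l)); exact: cf.
    exact: cst_continuous.
  by apply/funext => x; rewrite !mxE; ring.
exact: continuous_dotv.
Qed.

(* [l0] minimises the spread of [l i - q i]; the conclusion is the first-order
   condition at the minimum. *)
Lemma min_spread (R : realType) (n k : nat) (L : set 'rV[R]_n) (q : 'I_k -> 'rV[R]_n) :
  compact L -> is_convex L -> L !=set0 ->
  exists l0 : 'I_k -> 'rV[R]_n, (forall i, L (l0 i)) /\
    forall l : 'I_k -> 'rV[R]_n, (forall i, L (l i)) ->
      0 <= spread (fun i => l0 i - q i) (fun i => l i - l0 i).
Proof.
move=> kL cL [x0 Lx0].
(* Configurations in [L] form a compact set for the product topology by Tychonoff, so the continuous
   spread attains its minimum. *)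
pose T := prod_topology (fun _ : 'I_k => 'rV[R]_n : topologicalType).
have kLk : @compact T [set f | forall i, L (f i)]
  by exact: (@tychonoff _ (fun _ : 'I_k => 'rV[R]_n : topologicalType) (fun=> L) (fun=> kL)).
have cs : continuous (fun f : T => spread (fun i => f i - q i) (fun i => f i - q i)).
  apply: continuous_spread => i l f.
  apply: (@continuous_comp _ _ _ (fun f : T => f i) (fun x : 'rV[R]_n => x 0 l)).
    exact: (@proj_continuous _ _ i).
  exact: coord_continuous.
have [] := compact_EVT_min _ kLk (continuous_subspaceT cs).
  by exists (fun=> x0).
move=> l0 /set_mem/= Ll0 l0_min; exists l0; split=> // l Ll.
have : 0 <= 2 * spread (fun i => l0 i - q i) (fun i => l i - l0 i).
  apply: (@quadratic_slope_ge0 _ _ (spread (fun i => l i - l0 i) (fun i => l i - l0 i))).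
  (* By convexity the segment from [l0] to [l] stays in [L], and the spread along it is a quadratic
     polynomial in [t]. *)
  move=> t t0 t1; rewrite -(lerDl (spread (fun i => l0 i - q i) (fun i => l0 i - q i))).
  rewrite -spread_line; have := l0_min (fun i => t *: l i + (1 - t) *: l0 i).
  rewrite mem_set/= => [/(_ isT)|i]; last exact: cL.
  congr (_ <= _); congr spread; apply/funext => i; apply/rowP => j;
    by rewrite !mxE; ring.
by rewrite pmulr_rge0.
Qed.

(** * From projections to inscribed polytopes *)

(** At a minimiser of the spread, the first-order condition is tested against points of [L] supplied
    by a single projection, onto a subspace containing all [u i]; it forces the spread to vanish. *)
Lemma projections_translate_points (R : realType) (n d : nat) (L : set 'rV[R]_n)
    (q : 'I_d.+1 -> 'rV[R]_n) :
  compact L -> is_convex L -> L !=set0 -> (d <= n)%N ->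
  (forall A : 'M[R]_n, \rank A = d -> exists v : 'rV[R]_n, in_subspace A v /\
     translate (proj_set A (range q)) v `<=` proj_set A L) ->
  exists v, forall i, L (q i + v).
Proof.
move=> kL cL L0 dn hproj; have [l0 [Ll0 l0_min]] := min_spread q kL cL L0.
pose w i := l0 i - q i; pose u i := \sum_j (w i - w j).
have u0 : \sum_i u i = 0.
  rewrite /u; under eq_bigr do rewrite sumrB.
  by rewrite sumrB exchange_big /= subrr.
(* The [d.+1] vectors [u i] sum to zero, so they span dimension at most [d]. *)
have Ud : (\rank (\matrix_i u i) <= d)%N.
  rewrite -ltnS ltn_neqAle rank_leq_row andbT; apply/negP => Ufree.
  have : (const_mx 1 : 'rV[R]_d.+1) *m \matrix_i u i == 0.
    rewrite mulmx_sum_row -[eqbRHS]u0; apply/eqP; apply: eq_bigr => i _.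
    by rewrite mxE scale1r rowK.
  rewrite mulmx_free_eq0// => /eqP/rowP/(_ ord0)/eqP.
  by rewrite !mxE oner_eq0.
have [A [Ad UA]] := extend_subspace Ud dn.
have uA i : in_subspace A (u i).
  by rewrite /in_subspace; apply: submx_trans UA; rewrite -(rowK u i) row_sub.
have [v [vA hv]] := hproj A Ad.
(* The point of [L] above the translated projection of [q i] has the same inner product with [u i]
   as [q i + v]. *)
have /choice[l hl] : forall i, exists l, L l /\ dotv l (u i) = dotv (q i + v) (u i).
  move=> i; have [p pE] := orth_proj_exists A (q i).
  have [|l Ll [_ lE]] := hv (p + v); first by exists p => //; exists (q i).
  exists l; split=> //; have := lE _ (uA i); have := pE.2 _ (uA i).
  by rewrite !(dotvDl, dotvNl); lra.
have := l0_min l (fun i => (hl i).1).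
rewrite -/w spreadE.
have -> : \sum_i dotv (u i) (l i - l0 i) = - \sum_i dotv (u i) (w i).
  (* The translation [v] drops out because the [u i] sum to zero. *)
  have vu0 : \sum_i dotv v (u i) = 0 by rewrite -dotv_sumr u0 dotv0r.
  rewrite -sumrN -[LHS]subr0 -[X in _ - X]vu0 -sumrB; apply: eq_bigr => i _.
  rewrite !(dotvDr, dotvNr) [dotv (u i) (l i)]dotvC (hl i).2 dotvDl !(dotvC (u i)); ring.
rewrite mulrN -spreadE oppr_ge0 => w_le0.
have w0 : spread w w = 0 by apply/eqP; rewrite eq_le w_le0 spread_ge0.
exists (w ord0) => i; rewrite (spread_eq0 ord0 i w0) /w addrC subrK; exact: Ll0.
Qed.

Lemma projections_inscribed_polytopes (R : realType) (n d : nat) (K L : set 'rV[R]_n)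
    (Q : set 'rV[R]_n) :
  compact L -> is_convex L -> (d <= n)%N ->
  (forall A : 'M[R]_n, \rank A = d -> exists v : 'rV[R]_n, in_subspace A v /\
     translate (proj_set A K) v `<=` proj_set A L) ->
  is_polytope Q -> at_most_vertices Q d.+1 -> Q `<=` K ->
  exists v : 'rV[R]_n, translate Q v `<=` L.
Proof.
move=> kL cL dn hproj Qpoly [f hf] QK.
have [[q0 Qq0]|Q0] := pselect (Q !=set0); last first.
  by exists 0 => y [q Qq]; case: Q0; exists q.
have L0 : L !=set0.
  (* Extending the empty family gives some subspace of dimension [d]; the projection of [q0] then
     yields a point of [L]. *)
  have [A [Ad _]] := @extend_subspace R 0 n d 0 (leq_trans (rank_leq_row _) (leq0n d)) dn.
  have [v [_ hv]] := hproj A Ad; have [p pE] := orth_proj_exists A q0.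
  have [|l Ll _] := hv (p + v); last by exists l.
  by exists p => //; exists q0 => //; exact: QK.
(* The list [f] may contain points outside [Q]; these are replaced by [q0], while the vertices of
   [Q] are kept. *)
pose q i := if `[< Q (f i) >] then f i else q0.
have Qq i : Q (q i) by rewrite /q; case: ifPn => // /asboolP.
have [|v hv] := @projections_translate_points R n d L q kL cL L0 dn.
  move=> A /hproj[v [vA hv]]; exists v; split=> // _ [p [_ [i _ <-] pE] ->].
  by apply: hv; exists p => //; exists (q i) => //; exact/QK.
exists v => _ [x Qx ->].
(* The translate of [L] by [- v] is convex, so it contains [Q] once it contains the vertices of
   [Q]. *)
have cLv : is_convex [set y | L (y + v)].
  move=> y z t Ly Lz t0 t1 /=.
  rewrite (_ : _ + v = t *: (y + v) + (1 - t) *: (z + v)); first exact: cL.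
  by rewrite !scalerDr addrACA -scalerDl [t + _]addrC subrK scale1r.
apply: (conv_hull_min cLv _ (polytope_vertices Qpoly Qx)) => y yQ.
have [i yi] := hf y yQ; have := hv i; rewrite /q -yi asboolT//; exact: yQ.1.
Qed.

Theorem theorem2p3 (R : realType) (n d : nat) (K L : set 'rV[R]_n) :
  compact K -> is_convex K -> compact L -> is_convex L ->
  (1 <= d)%N -> (d <= n)%N ->
  ((forall Q : set 'rV[R]_n, is_polytope Q -> at_most_vertices Q d.+1 ->
       Q `<=` K -> exists v : 'rV[R]_n, translate Q v `<=` L)
   <->
   (forall A : 'M[R]_n, \rank A = d ->
       exists v : 'rV[R]_n, in_subspace A v /\
         translate (proj_set A K) v `<=` proj_set A L)).
Proof.
move=> _ cK kL cL _ dn; split=> [QKL A Ad|hproj Q].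
  by subst d; exact: inscribed_polytopes_projections.
exact: projections_inscribed_polytopes.
Qed.
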